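(* Let $I,J\subset\mathbb{R}$ be open intervals and let $u:I\to\mathbb{R}$, $v:J\to\mathbb{R}$ be smooth functions. Consider the translation surface of type 6 in the Heisenberg group $\mathrm{Nil}_3$, parametrized by $$r(x,y)=(y,v(y),0)*(0,x,u(x))=\Big(y,\,x+v(y),\,u(x)+\frac{xy}{2}\Big),\qquad (x,y)\in I\times J.$$ This surface is minimal if and only if one of the following holds: (i) there exist $u_0,a,b\in\mathbb{R}$ such that $u(x)=u_0$ for all $x\in I$ and $v(y)=\frac{a}{y}+b$ for all $y\in J$ with $y\neq0$; (ii) there exist $a,b,c,c_1\in\mathbb{R}$ such that $v(y)=ay+b$ for all $y\in J$ and $$u(x)=\frac{ax^2+abx+c}{2(1+a^2)}+c_1\left(\frac{x}{2}+\frac{b}{4}\right)\sqrt{4(1+a^2)+(2x+b)^2}+c_1(1+a^2)\ln\left(2x+b+\sqrt{4(1+a^2)+(2x+b)^2}\right)$$ for all $x\in I$.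
   Context: The Heisenberg group $\mathrm{Nil}_3$ is $\mathbb{R}^3$ with the group operation $$(x,y,z)*(\overline{x},\overline{y},\overline{z})=\Big(x+\overline{x},\ y+\overline{y},\ z+\overline{z}+\frac{x\overline{y}}{2}-\frac{\overline{x}y}{2}\Big),$$ equipped with the left invariant Riemannian metric $$\tilde g=dx^2+dy^2+\Big(dz+\tfrac12(y\,dx-x\,dy)\Big)^2.$$ A translation surface in $\mathrm{Nil}_3$ is a surface parametrized as the $*$-product of two curves lying in coordinate planes of $\mathbb{R}^3$. It is of type 6 when it is $M(\gamma_2,\gamma_1)=\gamma_2(y)*\gamma_1(x)$ with $\gamma_1(x)=(0,x,u(x))$ and $\gamma_2(y)=(y,v(y),0)$, $u,v$ smooth. A surface immersed in $(\mathrm{Nil}_3,\tilde g)$ is minimal if its mean curvature $H=\frac12\mathrm{trace}(A)$ vanishes identically, where $A$ is the shape operator with respect to a unit normal and the metric $\tilde g$. *)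

(* Defs.v *)
From HB Require Import structures.
From mathcomp Require Import all_boot all_order all_algebra.
From mathcomp Require Import all_classical all_reals all_analysis.
From mathcomp Require Import ring.

Set Implicit Arguments.
Unset Strict Implicit.
Unset Printing Implicit Defensive.

Import Order.TTheory GRing.Theory Num.Theory.
Import numFieldNormedType.Exports.

Local Open Scope classical_set_scope.
Local Open Scope ring_scope.

Definition smooth_on {R : realType} (I : set R) (f : R -> R) : Prop :=
  forall (n : nat) (x : R), I x -> derivable (derive1n n f) x 1.

Definition open_interval {R : realType} (I : set R) : Prop :=
  [/\ open I, is_interval I & I !=set0].

Definition partial {R : realType} {m : nat} (i : 'I_m) (f : 'rV[R]_m -> R)
    (q : 'rV[R]_m) : R :=
  'D_(delta_mx 0 i) f q.

(* Riemannian metrics on R^n are matrix fields g : 'rV_n -> 'M_n, tangent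
   vectors are rows, and g(v, w) is v *m g p *m w^T. *)

Definition inner {R : realType} {n : nat} (g : 'rV[R]_n -> 'M[R]_n)
    (p v w : 'rV[R]_n) : R :=
  (v *m g p *m w^T) 0 0.

(* Christoffel symbol Gamma^k_ij of the Levi-Civita connection of g. *)
Definition christoffel {R : realType} {n : nat} (g : 'rV[R]_n -> 'M[R]_n)
    (k i j : 'I_n) (p : 'rV[R]_n) : R :=
  2^-1 * \sum_(l < n) invmx (g p) k l *
    (partial i (fun p' => g p' j l) p + partial j (fun p' => g p' i l) p
     - partial l (fun p' => g p' i j) p).

(* Row i is the coordinate tangent vector of r in the i-th parameter. *)
Definition tangent {R : realType} {m n : nat} (r : 'rV[R]_m -> 'rV[R]_n)
    (q : 'rV[R]_m) : 'M[R]_(m, n) :=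
  \matrix_(i < m, k < n) partial i (fun q' => r q' 0 k) q.

(* Row i is the covariant derivative, in the i-th parameter, of the vector
   field V along r. *)
Definition covariant {R : realType} {m n : nat} (g : 'rV[R]_n -> 'M[R]_n)
    (r V : 'rV[R]_m -> 'rV[R]_n) (q : 'rV[R]_m) : 'M[R]_(m, n) :=
  \matrix_(i < m, k < n)
    (partial i (fun q' => V q' 0 k) q +
     \sum_(a < n) \sum_(b < n)
       christoffel g k a b (r q) * tangent r q i a * V q 0 b).

(* The covector w |-> det (r_0, r_1, w), whose kernel is the tangent plane
   when r is an immersion. *)
Definition conormal {R : realType} (r : 'rV[R]_2 -> 'rV[R]_3) (q : 'rV[R]_2)
    : 'rV[R]_3 :=
  \row_(k < 3) \det (col_mx (tangent r q) (delta_mx 0 k : 'rV[R]_3)).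

Definition normal_vector {R : realType} (g : 'rV[R]_3 -> 'M[R]_3)
    (r : 'rV[R]_2 -> 'rV[R]_3) (q : 'rV[R]_2) : 'rV[R]_3 :=
  conormal r q *m invmx (g (r q)).

Definition unit_normal {R : realType} (g : 'rV[R]_3 -> 'M[R]_3)
    (r : 'rV[R]_2 -> 'rV[R]_3) (q : 'rV[R]_2) : 'rV[R]_3 :=
  (Num.sqrt (inner g (r q) (normal_vector g r q) (normal_vector g r q)))^-1 *: normal_vector g r q.

(* Matrix of A X = - nabla_X N in the basis of coordinate tangent vectors:
   nabla_X N is tangent to the surface, and right multiplication by
   pinvmx (tangent r q) gives coordinates with respect to the rows of
   tangent r q. *)
Definition shape_operator {R : realType} (g : 'rV[R]_3 -> 'M[R]_3)
    (r : 'rV[R]_2 -> 'rV[R]_3) (q : 'rV[R]_2) : 'M[R]_2 :=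
  - covariant g r (unit_normal g r) q *m pinvmx (tangent r q).

Definition mean_curvature {R : realType} (g : 'rV[R]_3 -> 'M[R]_3)
    (r : 'rV[R]_2 -> 'rV[R]_3) (q : 'rV[R]_2) : R :=
  2^-1 * \tr (shape_operator g r q).

Definition immersed_on {R : realType} (D : set 'rV[R]_2)
    (r : 'rV[R]_2 -> 'rV[R]_3) : Prop :=
  forall q, D q -> row_free (tangent r q).

Definition minimal_on {R : realType} (g : 'rV[R]_3 -> 'M[R]_3)
    (D : set 'rV[R]_2) (r : 'rV[R]_2 -> 'rV[R]_3) : Prop :=
  immersed_on D r /\ forall q, D q -> mean_curvature g r q = 0.

Definition vec3 {R : realType} (x y z : R) : 'rV[R]_3 :=
  \row_(k < 3) [:: x; y; z]`_k.

Definition nil_mul {R : realType} (p p' : 'rV[R]_3) : 'rV[R]_3 :=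
  let x := p 0 0 in let y := p 0 1 in let z := p 0 2 in
  let x' := p' 0 0 in let y' := p' 0 1 in let z' := p' 0 2 in
  vec3 (x + x') (y + y') (z + z' + x * y' / 2 - x' * y / 2).

(* Coefficients of the 1-form dz + (y dx - x dy) / 2. *)
Definition nil_form {R : realType} (p : 'rV[R]_3) : 'rV[R]_3 :=
  vec3 (p 0 1 / 2) (- p 0 0 / 2) 1.

Definition nil_metric {R : realType} (p : 'rV[R]_3) : 'M[R]_3 :=
  delta_mx 0 0 + delta_mx 1 1 + (nil_form p)^T *m nil_form p.

Definition gamma1 {R : realType} (u : R -> R) (x : R) : 'rV[R]_3 :=
  vec3 0 x (u x).

Definition gamma2 {R : realType} (v : R -> R) (y : R) : 'rV[R]_3 :=
  vec3 y (v y) 0.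

(* The parameter is the row q = (x, y). *)
Definition translation_surface6 {R : realType} (u v : R -> R) (q : 'rV[R]_2)
    : 'rV[R]_3 :=
  nil_mul (gamma2 v (q 0 1)) (gamma1 u (q 0 0)).

Definition rectangle {R : realType} (I J : set R) : set 'rV[R]_2 :=
  [set q | I (q 0 0) /\ J (q 0 1)].

Lemma translation_surface6E {R : realType} (u v : R -> R) (q : 'rV[R]_2) :
  translation_surface6 u v q =
  vec3 (q 0 1) (q 0 0 + v (q 0 1)) (u (q 0 0) + q 0 0 * q 0 1 / 2).
Proof.
rewrite /translation_surface6 /nil_mul /gamma1 /gamma2 /vec3.
by congr (\row__ _); apply/funext => k; rewrite !mxE /=; congr nth;
   congr [:: _; _; _]; field.
Qed.

Lemma inner_nil_metric {R : realType} (p v : 'rV[R]_3) :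
  inner nil_metric p v v =
  v 0 0 ^+ 2 + v 0 1 ^+ 2 +
  (v 0 2 + (p 0 1 * v 0 0 - p 0 0 * v 0 1) / 2) ^+ 2.
Proof.
rewrite /inner /nil_metric /nil_form /vec3.
rewrite !mxE !big_ord_recl !big_ord0 !mxE !big_ord_recl !big_ord0 !mxE.
rewrite !big_ord_recl !big_ord0 !mxE /=.
have -> : lift ord0 (@ord0 1) = 1 :> 'I_3 by apply: val_inj.
have -> : lift ord0 (lift ord0 (@ord0 0)) = 2 :> 'I_3 by apply: val_inj.
by rewrite /=; field.
Qed.

(* Main.v *)
(* In the left-invariant frame the surface has tangent vectors (0, 1, p) and
   (1, v', w), where p = u' and w = x + (v - y v') / 2, and its mean curvature
   is a nonzero multiple of
     (1 + p^2) (p + y/2) v'' + v' + p w - (1 + v'^2 + w^2) p'.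
   If v'' vanishes identically, then v is affine and this is a linear first
   order equation for p, which integrates to (ii).  Otherwise, where v'' <> 0,
   differentiate in y, divide by v'' and differentiate twice more in y.  This
   leaves x only inside p and p', hence p' = (1 + p^2) (k p + l) with constants
   k and l; feeding this back into the previous equation yields a polynomial
   relation for p that forces p' = 0.  Then p is constant, the coefficient of x
   shows p = 0, and the remaining equation y v'' / 2 + v' = 0 says that y^2 v'
   is constant. *)

Require Import Defs.
From HB Require Import structures.
From mathcomp Require Import all_boot all_order all_algebra.
From mathcomp Require Import all_classical all_reals all_analysis.
From mathcomp Require Import ring lra.

Set Implicit Arguments.
Unset Strict Implicit.
Unset Printing Implicit Defensive.

Import Order.TTheory GRing.Theory Num.Theory.
Import numFieldNormedType.Exports.

Local Open Scope classical_set_scope.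
Local Open Scope ring_scope.

(** * Derivatives of real functions and partial derivatives *)

Section DerivativeRules.
Variables (R : realType) (x : R).
Implicit Types f g : R -> R.

Lemma is_derive_fun_cst (c : R) : is_derive x 1 (fun _ : R => c) (0 : R).
Proof. exact: is_derive_cst. Qed.

Lemma is_derive_fun_id : is_derive x 1 (fun t : R => t) (1 : R).
Proof. exact: is_derive_id. Qed.

Lemma is_derive_funD f g (df dg : R) :
  is_derive x 1 f df -> is_derive x 1 g dg ->
  is_derive x 1 (fun t => f t + g t) (df + dg).
Proof. exact: is_deriveD. Qed.

Lemma is_derive_funN f (df : R) :
  is_derive x 1 f df -> is_derive x 1 (fun t => - f t) (- df).
Proof. exact: is_deriveN. Qed.

Lemma is_derive_funM f g (df dg : R) :
  is_derive x 1 f df -> is_derive x 1 g dg ->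
  is_derive x 1 (fun t => f t * g t) (f x * dg + g x * df).
Proof. exact: is_deriveM. Qed.

Lemma is_derive_funX f (df : R) n :
  is_derive x 1 f df ->
  is_derive x 1 (fun t => f t ^+ n) (n%:R * f x ^+ n.-1 * df).
Proof.
move=> h; have -> : (fun t => f t ^+ n) = f ^+ n.
  by apply/funext => t; rewrite fctE.
exact: is_deriveX.
Qed.

Lemma is_derive_funV f (df : R) :
  is_derive x 1 f df -> f x != 0 ->
  is_derive x 1 (fun t => (f t)^-1) (- (f x) ^- 2 * df).
Proof. by move=> h fx0; exact: is_deriveV. Qed.

Lemma is_derive_fun_sqrt f (df : R) :
  is_derive x 1 f df -> 0 < f x ->
  is_derive x 1 (fun t => Num.sqrt (f t)) ((2 * Num.sqrt (f x))^-1 * df).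
Proof. by move=> h fx0; apply: is_derive1_comp => //; exact: is_derive1_sqrt. Qed.

Lemma is_derive_fun_ln f (df : R) :
  is_derive x 1 f df -> 0 < f x ->
  is_derive x 1 (fun t => ln (f t)) ((f x)^-1 * df).
Proof. by move=> h fx0; apply: is_derive1_comp => //; exact: is_derive1_ln. Qed.

End DerivativeRules.

(* [is_derive] is a class: resolution would decompose the goals along the
   library instances, before these rules apply. *)
Ltac derive_rules :=
  first
    [ eassumption
    | notypeclasses refine (is_derive_fun_cst _ _)
    | notypeclasses refine (is_derive_fun_id _)
    | notypeclasses refine (is_derive_funD _ _); derive_rules
    | notypeclasses refine (is_derive_funN _); derive_rules
    | notypeclasses refine (is_derive_funM _ _); derive_rules
    | notypeclasses refine (is_derive_funX _ _); derive_rules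
    | notypeclasses refine (is_derive_funV _ _); [derive_rules | ]
    | notypeclasses refine (is_derive_fun_sqrt _ _); [derive_rules | ]
    | notypeclasses refine (is_derive_fun_ln _ _); [derive_rules | ] ].

Ltac derive_auto :=
  notypeclasses refine (is_derive_eq _ _); [derive_rules | cbv beta; rewrite ?/id].

Lemma forall_ord3 (P : 'I_3 -> Prop) : P 0 -> P 1 -> P 2 -> forall k, P k.
Proof.
move=> P0 P1 P2 [[|[|[|//]]] hk].
- by rewrite (_ : Ordinal hk = 0) //; apply: val_inj.
- by rewrite (_ : Ordinal hk = 1) //; apply: val_inj.
- by rewrite (_ : Ordinal hk = 2) //; apply: val_inj.
Qed.

Lemma forall_ord2 (P : 'I_2 -> Prop) : P 0 -> P 1 -> forall k, P k.
Proof.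
move=> P0 P1 [[|[|//]] hk].
- by rewrite (_ : Ordinal hk = 0) //; apply: val_inj.
- by rewrite (_ : Ordinal hk = 1) //; apply: val_inj.
Qed.

Lemma sum_ord3 (V : nmodType) (F : 'I_3 -> V) : \sum_(k < 3) F k = F 0 + F 1 + F 2.
Proof.
rewrite !big_ord_recl big_ord0 addr0 addrA.
by congr (F _ + F _ + F _); apply: val_inj.
Qed.

Lemma sum_ord2 (V : nmodType) (F : 'I_2 -> V) : \sum_(k < 2) F k = F 0 + F 1.
Proof.
rewrite !big_ord_recl big_ord0 addr0.
by congr (F _ + F _); apply: val_inj.
Qed.

Definition update {R : realType} {m : nat} (q : 'rV[R]_m) (i : 'I_m) (s : R) :
  'rV[R]_m := \row_j (if j == i then s else q 0 j).

(** The difference quotients coincide, so partial derivatives become one-variable derivatives, to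
    which the rules above apply. *)
Lemma partialE (R : realType) (m : nat) (i : 'I_m) (f : 'rV[R]_m -> R)
    (q : 'rV[R]_m) :
  partial i f q = 'D_1 (fun s => f (update q i s)) (q 0 i).
Proof.
have updE (h : R) : update q i (h *: (1 : R) + q 0 i) = h *: delta_mx 0 i + q.
  apply/rowP => j; rewrite !mxE eqxx /= /GRing.scale /= mulr1.
  by case: eqVneq => [->|_]; rewrite ?mulr1 // mulr0 add0r.
have upd0 : update q i (q 0 i) = q.
  by apply/rowP => j; rewrite !mxE; case: eqVneq => [->|].
rewrite /partial /derive; apply: (congr1 (fun g => lim (g @ 0^'))); apply/funext => h /=.
by rewrite updE upd0.
Qed.

(** Only the germ of [f] along the coordinate line matters; the closed form of the unit normal is
    available on the open rectangle only. *)
Lemma near_partial (R : realType) (m : nat) (i : 'I_m) (f : 'rV[R]_m -> R)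
    (q : 'rV[R]_m) (h : R -> R) (d : R) :
  (\forall s \near q 0 i, f (update q i s) = h s) ->
  is_derive (q 0 i) 1 h d -> partial i f q = d.
Proof.
move=> fh dh; rewrite partialE (near_eq_derive _ fh).
by case: dh.
Qed.

Lemma is_derive_partial (R : realType) (m : nat) (i : 'I_m) (f : 'rV[R]_m -> R)
    (q : 'rV[R]_m) (d : R) :
  is_derive (q 0 i) 1 (fun s => f (update q i s)) d -> partial i f q = d.
Proof. by move=> dh; apply: near_partial dh; exact: filterE. Qed.

(** * The Levi-Civita connection of the metric *)

(** Constant Jacobian of the components of [nil_form], the row being the direction of
    differentiation; being antisymmetric, it is half of the exterior derivative. *)
Definition nil_dform {R : realType} : 'M[R]_3 :=
  2^-1 *: (delta_mx 1 0 - delta_mx 0 1).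

Lemma nil_form_deriv (R : realType) (p : 'rV[R]_3) (i j : 'I_3) :
  is_derive (p 0 i) 1 (fun s => nil_form (update p i s) 0 j) (nil_dform i j).
Proof.
move: i j; apply: forall_ord3; apply: forall_ord3;
  rewrite /nil_dform !mxE /=;
  under [fun s => _]eq_fun do rewrite !mxE /= ?mxE /=;
  by derive_auto; ring.
Qed.

Lemma partial_nil_metric (R : realType) (p : 'rV[R]_3) (i j l : 'I_3) :
  partial i (fun p' => nil_metric p' j l) p =
  nil_form p 0 j * nil_dform i l + nil_form p 0 l * nil_dform i j.
Proof.
have hj := @nil_form_deriv _ p i j; have hl := @nil_form_deriv _ p i l.
have upd0 : update p i (p 0 i) = p.
  by apply/rowP => k; rewrite !mxE; case: eqVneq => [->|].
(* The right-hand side takes the shape produced by the sum and product rules, [0] coming from the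
   constant part of the metric. *)
have -> : nil_form p 0 j * nil_dform i l + nil_form p 0 l * nil_dform i j =
    0 + (nil_form (update p i (p 0 i)) 0 j * nil_dform i l +
         nil_form (update p i (p 0 i)) 0 l * nil_dform i j).
  by rewrite upd0 add0r.
apply: is_derive_partial.
have -> : (fun s => nil_metric (update p i s) j l) =
   (fun s => (delta_mx 0 0 + delta_mx 1 1 : 'M[R]_3) j l +
      nil_form (update p i s) 0 j * nil_form (update p i s) 0 l).
  by apply/funext => s; rewrite /nil_metric !mxE big_ord1 !mxE.
by derive_rules.
Qed.

(** [e1], [e2], [e3] form the left-invariant orthonormal frame, so the sum of their tensor squares
    is the inverse metric. *)
Definition nil_cometric {R : realType} (p : 'rV[R]_3) : 'M[R]_3 :=
  let e1 := vec3 1 0 (- p 0 1 / 2) in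
  let e2 := vec3 0 1 (p 0 0 / 2) in
  let e3 := vec3 0 0 1 in
  e1^T *m e1 + e2^T *m e2 + e3^T *m e3.

Lemma invmx_nil_metric (R : realType) (p : 'rV[R]_3) :
  invmx (nil_metric p) = nil_cometric p.
Proof.
have h : nil_metric p *m nil_cometric p = 1%:M.
  apply/matrixP => i j; rewrite !mxE sum_ord3 !mxE !big_ord1 !mxE /=.
  by move: i j; apply: forall_ord3; apply: forall_ord3; rewrite /=; field.
have [u1 _] := mulmx1_unit h.
by apply: (can_inj (mulKmx u1)); rewrite mulmxV.
Qed.

(* Row [i] is the vector dual to the 1-form [iota_(d_i) d theta], where
   [theta = nil_form]. *)
Definition nil_twist {R : realType} (p : 'rV[R]_3) : 'M[R]_3 :=
  \matrix_(i < 3) (vec3 (i == 1)%:R (- (i == 0)%:R)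
     (- ((i == 0)%:R * p 0 0 + (i == 1)%:R * p 0 1) / 2)).

(* No symmetric derivatives of [nil_form] appear: it is dual to a Killing
   field, so [d_i theta_j + d_j theta_i = 0]. *)
Lemma christoffel_nil (R : realType) (p : 'rV[R]_3) (k i j : 'I_3) :
  christoffel nil_metric k i j p =
  2^-1 * (nil_form p 0 j * nil_twist p i k + nil_form p 0 i * nil_twist p j k).
Proof.
rewrite /christoffel invmx_nil_metric; congr (_ * _).
have twist a : nil_twist p a k = 2 * \sum_(l < 3) nil_cometric p k l * nil_dform a l.
  rewrite sum_ord3 !mxE !big_ord1 !mxE /=.
  by move: a k; apply: forall_ord3; apply: forall_ord3; rewrite /=; field.
rewrite !twist !sum_ord3 !partial_nil_metric.
have dformN a b : nil_dform a b = - nil_dform b a :> R.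
  by move: a b; apply: forall_ord3; apply: forall_ord3; rewrite !mxE /=; ring.
rewrite (dformN 0 i) (dformN 0 j) (dformN 1 i) (dformN 1 j).
rewrite (dformN 2 i) (dformN 2 j) (dformN i j).
ring.
Qed.

(** Each Christoffel symbol is a symmetrized product of one factor per lower index, so the double
    sum splits into products of single sums. *)
Lemma covariant_nil (R : realType) (r V : 'rV[R]_2 -> 'rV[R]_3) (q : 'rV[R]_2)
    (i : 'I_2) (k : 'I_3) :
  covariant nil_metric r V q i k =
  partial i (fun q' => V q' 0 k) q + 2^-1 *
   ((\sum_(b < 3) nil_form (r q) 0 b * V q 0 b) *
    (\sum_(a < 3) tangent r q i a * nil_twist (r q) a k) +
    (\sum_(a < 3) nil_form (r q) 0 a * tangent r q i a) *
    (\sum_(b < 3) V q 0 b * nil_twist (r q) b k)).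
Proof.
rewrite [LHS]mxE; congr (_ + _); rewrite !sum_ord3 !christoffel_nil; ring.
Qed.

(** * General tools: small determinants, shape operator, normalization *)

Lemma det_mx22 (R : comNzRingType) (A : 'M[R]_2) :
  \det A = A 0 0 * A 1 1 - A 0 1 * A 1 0.
Proof.
rewrite (expand_det_row _ 0) sum_ord2 /cofactor !det_mx11 !mxE /=.
have -> : lift 0 0 = 1 :> 'I_2 by apply: val_inj.
have -> : lift 1 0 = 0 :> 'I_2 by apply: val_inj.
ring.
Qed.

Lemma det_mx33 (R : comNzRingType) (A : 'M[R]_3) :
  \det A = A 0 0 * (A 1 1 * A 2 2 - A 1 2 * A 2 1)
         - A 0 1 * (A 1 0 * A 2 2 - A 1 2 * A 2 0)
         + A 0 2 * (A 1 0 * A 2 1 - A 1 1 * A 2 0).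
Proof.
rewrite (expand_det_row _ 0) sum_ord3 /cofactor !det_mx22 !mxE /=.
have -> : lift 0 0 = 1 :> 'I_3 by apply: val_inj.
have -> : lift 0 1 = 2 :> 'I_3 by apply: val_inj.
have -> : lift 1 0 = 0 :> 'I_3 by apply: val_inj.
have -> : lift 1 1 = 2 :> 'I_3 by apply: val_inj.
have -> : lift 2 0 = 0 :> 'I_3 by apply: val_inj.
have -> : lift 2 1 = 1 :> 'I_3 by apply: val_inj.
ring.
Qed.

(** Row-freeness lets [pinvmx] cancel the tangent matrix, so exhibiting a factor [S] avoids
    computing the pseudo-inverse. *)
Lemma mean_curvature_factor (R : realType) (g : 'rV[R]_3 -> 'M[R]_3)
    (r : 'rV[R]_2 -> 'rV[R]_3) (q : 'rV[R]_2) (S : 'M[R]_2) :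
  row_free (tangent r q) ->
  covariant g r (unit_normal g r) q = S *m tangent r q ->
  mean_curvature g r q = - (2^-1 * \tr S).
Proof.
move=> rf CS.
by rewrite /mean_curvature /shape_operator CS mulNmx mulmxKp // linearN mulrN.
Qed.

Lemma smooth_is_derive (R : realType) (I : set R) (f : R -> R) n (x : R) :
  smooth_on I f -> I x -> is_derive x 1 (derive1n n f) (derive1n n.+1 f x).
Proof. by move=> hf Ix; apply: DeriveDef; [exact: hf | rewrite /= derive1E]. Qed.

(** With the power of the square root pulled out, the remaining factor is free of roots. *)
Lemma is_derive_normalize (R : realType) (n Q : R -> R) (x dn dQ : R) :
  is_derive x 1 n dn -> is_derive x 1 Q dQ -> 0 < Q x ->
  is_derive x 1 (fun s => (Num.sqrt (Q s))^-1 * n s)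
    (Num.sqrt (Q x) ^- 3 * (Q x * dn - dQ / 2 * n x)).
Proof.
move=> hn hQ Q0; have S0 : Num.sqrt (Q x) != 0 by rewrite sqrtr_eq0 -ltNge.
derive_auto; [by [] | by [] | ].
have := sqr_sqrtr (ltW Q0); move: (Num.sqrt (Q x)) S0 => S S0 <-.
by field.
Qed.

(** * Mean curvature of the translation surface *)

Local Arguments derive1n : simpl never.

Section TranslationSurface.
Variables (R : realType) (I J : set R) (u v : R -> R).
Hypotheses (oI : open I) (oJ : open J) (hu : smooth_on I u) (hv : smooth_on J v).

Local Notation u1 := (derive1n 1 u).
Local Notation u2 := (derive1n 2 u).
Local Notation v1 := (derive1n 1 v).
Local Notation v2 := (derive1n 2 v).
Local Notation r := (translation_surface6 u v).

(* Left-invariant frame components of [r_x] and [r_y] are [(0, 1, u1 x)] and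
   [(1, v1 y, frame3 x y)]. *)
Definition frame3 (x y : R) : R := x + (v y - y * v1 y) / 2.

Definition normal1 (x y : R) : R := frame3 x y - u1 x * v1 y.

(** In the left-invariant frame this is [(normal1 x y, u1 x, -1)], the cross product of the frame
    components of [r_x] and [r_y]; the last entry comes from the change to coordinates. *)
Definition normal3 (x y : R) : 'rV[R]_3 :=
  vec3 (normal1 x y) (u1 x)
    (- 1 - normal1 x y * (x + v y) / 2 + u1 x * y / 2).

Definition normal_sqnorm (x y : R) : R := normal1 x y ^+ 2 + u1 x ^+ 2 + 1.

Definition minimal_defect (x y : R) : R :=
  (1 + u1 x ^+ 2) * (u1 x + y / 2) * v2 y + v1 y + u1 x * frame3 x y
  - (1 + v1 y ^+ 2 + frame3 x y ^+ 2) * u2 x.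

Let du0 x : I x -> is_derive x 1 u (u1 x).
Proof. exact: (smooth_is_derive 0). Qed.
Let du1 x : I x -> is_derive x 1 u1 (u2 x).
Proof. exact: (smooth_is_derive 1). Qed.
Let dv0 x : J x -> is_derive x 1 v (v1 x).
Proof. exact: (smooth_is_derive 0). Qed.
Let dv1 x : J x -> is_derive x 1 v1 (v2 x).
Proof. exact: (smooth_is_derive 1). Qed.

Lemma tangent_translation6 (q : 'rV[R]_2) : rectangle I J q ->
  tangent r q = \matrix_(i < 2, k < 3)
    (if i == 0 then vec3 0 1 (u1 (q 0 0) + q 0 1 / 2)
     else vec3 1 (v1 (q 0 1)) (q 0 0 / 2)) 0 k.
Proof.
case=> Iq Jq; have hu0 := du0 Iq; have hv0 := dv0 Jq.
apply/matrixP => i k; rewrite !mxE; apply: is_derive_partial.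
under eq_fun do rewrite translation_surface6E !mxE.
move: i k; apply: forall_ord2; apply: forall_ord3; rewrite /= ?mxE /=;
  by derive_auto; field.
Qed.

Lemma immersed_translation6 : immersed_on (rectangle I J) r.
Proof.
move=> q /tangent_translation6 ->.
(* The first two columns of the tangent matrix have rows [(0, 1)] and [(1, v1)]; the inverse of this
   block, padded by a zero row, is a right inverse. *)
apply/row_freeP; exists (\matrix_(k < 3, i < 2)
  (if i == 0 then vec3 (- v1 (q 0 1)) 1 0 else vec3 1 0 0) 0 k).
apply/matrixP => i j; rewrite !mxE sum_ord3 !mxE.
by move: i j; apply: forall_ord2; apply: forall_ord2; rewrite /= !mxE /=; ring.
Qed.

Lemma conormal_translation6 (q : 'rV[R]_2) : rectangle I J q ->
  conormal r q =
  vec3 (q 0 0 / 2 - (u1 (q 0 0) + q 0 1 / 2) * v1 (q 0 1))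
    (u1 (q 0 0) + q 0 1 / 2) (-1).
Proof.
move=> Dq; apply/rowP => k; rewrite mxE det_mx33.
have e0 : (0 : 'I_3) = lshift 1 (0 : 'I_2) by apply: val_inj.
have e1 : (1 : 'I_3) = lshift 1 (1 : 'I_2) by apply: val_inj.
have e2 : (2 : 'I_3) = rshift 2 (0 : 'I_1) by apply: val_inj.
pose T : 'M[R]_3 := col_mx (tangent r q) (delta_mx 0 k : 'rV[R]_3).
have T0 l : T 0 l = tangent r q 0 l by rewrite (congr1 (T^~ l) e0); exact: col_mxEu.
have T1 l : T 1 l = tangent r q 1 l by rewrite (congr1 (T^~ l) e1); exact: col_mxEu.
have T2 l : T 2 l = (l == k)%:R.
  rewrite (congr1 (T^~ l) e2); apply: etrans (col_mxEd _ _ _ _) _.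
  by rewrite mxE eqxx.
rewrite -/T !T0 !T1 !T2 tangent_translation6 // !mxE /=.
by move: k {T T0 T1 T2}; apply: forall_ord3; rewrite /=; field.
Qed.

Lemma normal_vector_translation6 (q : 'rV[R]_2) : rectangle I J q ->
  normal_vector nil_metric r q = normal3 (q 0 0) (q 0 1).
Proof.
move=> Dq; rewrite /normal_vector conormal_translation6 // invmx_nil_metric.
rewrite translation_surface6E /normal3 /normal1 /frame3.
apply/rowP => k; rewrite !mxE sum_ord3 !mxE !big_ord1 !mxE /=.
by move: k; apply: forall_ord3; rewrite /=; field.
Qed.

Lemma unit_normal_translation6 (q : 'rV[R]_2) k : rectangle I J q ->
  unit_normal nil_metric r q 0 k =
  (Num.sqrt (normal_sqnorm (q 0 0) (q 0 1)))^-1 * normal3 (q 0 0) (q 0 1) 0 k.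
Proof.
move=> Dq; rewrite /unit_normal normal_vector_translation6 // mxE.
congr ((Num.sqrt _)^-1 * _).
rewrite inner_nil_metric translation_surface6E /normal_sqnorm !mxE /=.
by field.
Qed.

Definition normal1_x (x y : R) : R := 1 - u2 x * v1 y.

Definition normal1_y (x y : R) : R := - (y / 2 + u1 x) * v2 y.

Definition normal3_deriv (i : 'I_2) (x y : R) : 'rV[R]_3 :=
  if i == 0 then
    vec3 (normal1_x x y) (u2 x)
      (- (normal1_x x y * (x + v y) + normal1 x y) / 2 + u2 x * y / 2)
  else
    vec3 (normal1_y x y) 0
      (- (normal1_y x y * (x + v y) + normal1 x y * v1 y) / 2 + u1 x / 2).

Definition normal_sqnorm_deriv (i : 'I_2) (x y : R) : R :=
  if i == 0 then 2 * (normal1 x y * normal1_x x y + u1 x * u2 x)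
  else 2 * (normal1 x y * normal1_y x y).

Lemma normal_sqnorm_gt0 x y : 0 < normal_sqnorm x y.
Proof. by rewrite /normal_sqnorm ltr_wpDl // addr_ge0 // sqr_ge0. Qed.

Lemma partial_unit_normal (q : 'rV[R]_2) (i : 'I_2) (k : 'I_3) :
  rectangle I J q ->
  partial i (fun q' => unit_normal nil_metric r q' 0 k) q =
  let x := q 0 0 in let y := q 0 1 in
  Num.sqrt (normal_sqnorm x y) ^- 3 *
  (normal_sqnorm x y * normal3_deriv i x y 0 k
   - normal_sqnorm_deriv i x y / 2 * normal3 x y 0 k).
Proof.
case=> Iq Jq /=; move: i; apply: forall_ord2.
- apply: (near_partial (h := fun s =>
    (Num.sqrt (normal_sqnorm s (q 0 1)))^-1 * normal3 s (q 0 1) 0 k)).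
    near=> s; have Ds : rectangle I J (update q 0 s).
      by split; rewrite !mxE //=; near: s; exact: open_nbhs_nbhs.
    by rewrite unit_normal_translation6 // !mxE.
  have hu0 := du0 Iq; have hu1 := du1 Iq.
  notypeclasses refine (@is_derive_normalize _ (fun s => normal3 s (q 0 1) 0 k)
    (fun s => normal_sqnorm s (q 0 1)) _ _ _ _ _ (normal_sqnorm_gt0 _ _)).
    rewrite /normal3 /normal3_deriv /normal1_x /normal1 /frame3 /=.
    under eq_fun do rewrite mxE; rewrite mxE.
    by move: k; apply: forall_ord3; rewrite /=; derive_auto; field.
  rewrite /normal_sqnorm /normal_sqnorm_deriv /normal1_x /normal1 /frame3 /=.
  by derive_auto; rewrite /=; field.
- apply: (near_partial (h := fun s =>
    (Num.sqrt (normal_sqnorm (q 0 0) s))^-1 * normal3 (q 0 0) s 0 k)).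
    near=> s; have Ds : rectangle I J (update q 1 s).
      by split; rewrite !mxE //=; near: s; exact: open_nbhs_nbhs.
    by rewrite unit_normal_translation6 // !mxE.
  have hv0 := dv0 Jq; have hv1 := dv1 Jq.
  notypeclasses refine (@is_derive_normalize _ (fun s => normal3 (q 0 0) s 0 k)
    (fun s => normal_sqnorm (q 0 0) s) _ _ _ _ _ (normal_sqnorm_gt0 _ _)).
    rewrite /normal3 /normal3_deriv /normal1_y /normal1 /frame3 /=.
    under eq_fun do rewrite mxE; rewrite mxE.
    by move: k; apply: forall_ord3; rewrite /=; derive_auto; field.
  rewrite /normal_sqnorm /normal_sqnorm_deriv /normal1_y /normal1 /frame3 /=.
  by derive_auto; rewrite /=; field.
Unshelve. all: by end_near. Qed.

Lemma mean_curvature_translation6 (q : 'rV[R]_2) : rectangle I J q ->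
  let x := q 0 0 in let y := q 0 1 in
  mean_curvature nil_metric r q =
  2^-1 * Num.sqrt (normal_sqnorm x y) ^- 3 * minimal_defect x y.
Proof.
move=> Dq /=; set x := q 0 0; set y := q 0 1.
set Q := normal_sqnorm x y; set W := Num.sqrt Q.
have WQ : W ^+ 2 = Q by rewrite sqr_sqrtr // ltW // normal_sqnorm_gt0.
have W0 : W != 0 by rewrite sqrtr_eq0 -ltNge normal_sqnorm_gt0.
(* [a] is [W ^ 3] times the covariant derivative of the unit normal; it contains no square root. *)
pose a (i : 'I_2) (k : 'I_3) : R :=
  Q * normal3_deriv i x y 0 k - normal_sqnorm_deriv i x y / 2 * normal3 x y 0 k
  + Q / 2 * ((\sum_(b < 3) nil_form (r q) 0 b * normal3 x y 0 b) *
      (\sum_(a < 3) tangent r q i a * nil_twist (r q) a k) +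
      (\sum_(a < 3) nil_form (r q) 0 a * tangent r q i a) *
      (\sum_(b < 3) normal3 x y 0 b * nil_twist (r q) b k)).
have CE i k : covariant nil_metric r (unit_normal nil_metric r) q i k = W ^- 3 * a i k.
  rewrite covariant_nil partial_unit_normal // -/x -/y -/Q -/W /a !sum_ord3.
  rewrite !unit_normal_translation6 // -/x -/y -/Q -/W -WQ.
  by field.
(* The tangent vectors start with [(0, 1)] and [(1, v1 y)], so the first two coordinates of a
   tangent vector determine its coefficients. *)
pose S : 'M[R]_2 := \matrix_(i, j)
  (W ^- 3 * (if j == 0 then a i 1 - v1 y * a i 0 else a i 0)).
have tangentE := tangent_translation6 Dq.
(* The third equation is tangency: the last coordinate is the same combination of the last
   coordinates of [r_x] and [r_y]. *)
have aE i : (a i 0 = Q * normal3_deriv i x y 0 0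
      - normal_sqnorm_deriv i x y / 2 * normal3 x y 0 0
      + Q / 2 * (if i == 0 then u1 x * u1 x - 1
                 else frame3 x y * u1 x - v1 y)) *
  (a i 1 = Q * normal3_deriv i x y 0 1
      - normal_sqnorm_deriv i x y / 2 * normal3 x y 0 1
      + Q / 2 * (if i == 0 then - u1 x * normal1 x y
                 else 1 - frame3 x y * normal1 x y)) *
  (a i 2 = (a i 1 - v1 y * a i 0) * (u1 x + y / 2) + a i 0 * (x / 2)).
  rewrite /a !sum_ord3 tangentE translation_surface6E !mxE /= -/x -/y /Q.
  rewrite /normal_sqnorm /normal1 /frame3 /normal3_deriv /normal_sqnorm_deriv.
  rewrite /normal1_x /normal1_y /normal1 /frame3.
  by move: i; apply: forall_ord2; rewrite /= !mxE /=; do 2?split; field.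
have CS : covariant nil_metric r (unit_normal nil_metric r) q = S *m tangent r q.
  apply/matrixP => i j; rewrite CE mxE sum_ord2 tangentE !mxE /= -/x -/y.
  by move: j; apply: forall_ord3; rewrite /= ?(aE i).2; field.
rewrite (mean_curvature_factor (immersed_translation6 Dq) CS).
rewrite /mxtrace sum_ord2 !mxE /= !aE /= /normal3_deriv /normal_sqnorm_deriv !mxE /=.
rewrite /minimal_defect /Q /normal_sqnorm /normal1_x /normal1_y /normal1.
move: (frame3 x y) (u1 x) (u2 x) (v1 y) (v2 y) (W ^- 3) => f p p' s s' w.
by field.
Qed.

Lemma minimal_translation6P :
  minimal_on nil_metric (rectangle I J) r <->
  (forall x y, I x -> J y -> minimal_defect x y = 0).
Proof.
split=> [[_ H0] x y Ix Jy | H0].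
  pose q : 'rV[R]_2 := \row_j (if j == 0 then x else y).
  have Dq : rectangle I J q by split; rewrite mxE.
  have := H0 _ Dq; rewrite mean_curvature_translation6 // !mxE /= => /eqP.
  rewrite mulf_eq0 gt_eqF ?orFb => [/eqP //|].
  by rewrite mulr_gt0 ?invr_gt0 // exprn_gt0 // sqrtr_gt0 normal_sqnorm_gt0.
split; first exact: immersed_translation6.
by move=> q Dq; rewrite mean_curvature_translation6 // H0 ?mulr0 //; case: Dq.
Qed.

End TranslationSurface.

(** * Consequences of the minimal surface equation *)

Lemma open_near (R : realType) (I : set R) (x : R) :
  open I -> I x -> \forall t \near x, I t.
Proof. by move=> oI Ix; exact: open_nbhs_nbhs. Qed.

(** Supplies the open sets on which one may divide by a function and then differentiate again. *)
Lemma open_neq0 (R : realType) (I : set R) (f df : R -> R) :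
  open I -> (forall x, I x -> is_derive x 1 f (df x)) ->
  open [set x | I x /\ f x != 0].
Proof.
move=> oI df_; rewrite openE => x [Ix fx0]; rewrite /interior /=.
have cf : {for x, continuous f}.
  by apply: differentiable_continuous; apply/derivable1_diffP; case: (df_ x Ix).
near=> t; split; first by near: t; exact: open_near.
by near: t; exact: (cvgr_neq0 (f x)).
Unshelve. all: by end_near. Qed.

(** Differentiates an identity that holds on an open set: both sides have the same germ at each of
    its points. *)
Lemma is_derive_unique_on (R : realType) (I : set R) (f g : R -> R) (x df dg : R) :
  open I -> (forall t, I t -> f t = g t) -> I x ->
  is_derive x 1 f df -> is_derive x 1 g dg -> df = dg.
Proof.
move=> oI fg Ix [_ <-] [_ <-]; apply: near_eq_derive.
by near=> t; apply: fg; near: t; exact: open_near.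
Unshelve. all: by end_near. Qed.

Lemma is_derive_zero_on (R : realType) (I : set R) (f : R -> R) (x df : R) :
  open I -> (forall t, I t -> f t = 0) -> I x -> is_derive x 1 f df -> df = 0.
Proof.
move=> oI f0 Ix hf.
exact: is_derive_unique_on oI f0 Ix hf (is_derive_fun_cst x 0).
Qed.

Lemma is_derive0_interval (R : realType) (I : set R) (f : R -> R) (x y : R) :
  is_interval I -> (forall t, I t -> is_derive t 1 f (0 : R)) -> I x -> I y ->
  f x = f y.
Proof.
move=> iI df; wlog xy : x y / x <= y => [H Ix Iy|Ix Iy].
  by case: (leP x y) => [/H|/ltW /H] h; [exact: h|apply/esym; exact: h].
have Ixy t : t \in `[x, y]%R -> I t by rewrite in_itv; exact: iI.
have [| |c _] := MVT_segment (f := f) (df := fun=> 0) xy.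
- by move=> t txy; apply/df/Ixy; exact: subset_itv_oo_cc.
- apply: derivable_within_continuous => t /Ixy /df; by case.
- by rewrite mul0r => /eqP; rewrite subr_eq0 => /eqP.
Qed.

(* Iterating this shows that a polynomial vanishing along a nonconstant
   function has vanishing coefficients. *)
Lemma derive_zero_along (R : realType) (I : set R) (p dp F dF : R -> R) :
  open I -> (forall x, I x -> is_derive x 1 p (dp x)) ->
  (forall x, I x -> dp x != 0) -> (forall t : R, is_derive t 1 F (dF t)) ->
  (forall x, I x -> F (p x) = 0) -> forall x, I x -> dF (p x) = 0.
Proof.
move=> oI hp dp0 hF F0 x Ix.
have hc : is_derive x 1 (fun t => F (p t)) (dF (p x) * dp x).
  exact: (@is_derive1_comp _ F p x _ _ (hF (p x)) (hp x Ix)).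
have := is_derive_zero_on oI F0 Ix hc.
by move/eqP; rewrite mulf_eq0 (negbTE (dp0 x Ix)) orbF => /eqP.
Qed.

Lemma onep_sqr_neq0 (R : realType) (t : R) : 1 + t ^+ 2 != 0.
Proof. by rewrite gt_eqF // ltr_pwDl // sqr_ge0. Qed.

(* Differentiating the second relation allows one to eliminate [x]; what is left
   is a quartic polynomial in [p x] whose vanishing forces [k = l = 0]. *)
Lemma riccati_constant (R : realType) (I : set R) (p dp ddp : R -> R) (k l A B : R) :
  open I -> (forall x, I x -> is_derive x 1 p (dp x)) ->
  (forall x, I x -> is_derive x 1 dp (ddp x)) ->
  (forall x, I x -> dp x = (1 + p x ^+ 2) * (k * p x + l)) ->
  (forall x, I x ->
     x * (k * p x + l) - p x / (2 * (1 + p x ^+ 2)) + A * p x + B = 0) ->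
  forall x, I x -> dp x = 0.
Proof.
move=> oI hp hdp riccati aff x0 Ix0; apply/eqP; apply/negPn/negP => dpx0.
pose K := [set x | I x /\ dp x != 0].
have oK : open K by exact: open_neq0 hdp.
have hpK x : K x -> is_derive x 1 p (dp x) by case=> /hp.
have dpK x : K x -> dp x != 0 by case.
have Kx0 : K x0 by [].
pose C := 2 * k * B - 2 * A * l.
(* Up to the factor [2 (1 + p^2)^2], this is [k] times the second relation after elimination of
   [x k]. The terms [k A p] cancel, so [A] and [B] enter only through [C]. *)
pose F0 (t : R) := C * (1 + t ^+ 2) ^+ 2 - 4 * k * t ^+ 3 - 3 * l * t ^+ 2
   - 2 * k * t - l.
pose F1 (t : R) := C * (4 * t + 4 * t ^+ 3) - 12 * k * t ^+ 2 - 6 * l * t - 2 * k.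
pose F2 (t : R) := C * (4 + 12 * t ^+ 2) - 24 * k * t - 6 * l.
pose F3 (t : R) := 24 * C * t - 24 * k.
have d0 (t : R) : is_derive t 1 F0 (F1 t).
  by rewrite /F0 /F1; derive_auto; rewrite /=; ring.
have d1 (t : R) : is_derive t 1 F1 (F2 t).
  by rewrite /F1 /F2; derive_auto; rewrite /=; ring.
have d2 (t : R) : is_derive t 1 F2 (F3 t).
  by rewrite /F2 /F3; derive_auto; rewrite /=; ring.
have d3 (t : R) : is_derive t 1 F3 (24 * C).
  by rewrite /F3; derive_auto; rewrite /=; ring.
have P0 x : K x -> F0 (p x) = 0.
  move=> Kx; have [Ix dpx] := Kx; have hpx := hp _ Ix.
  have n1 := onep_sqr_neq0 (p x).
  have hder : is_derive x 1 (fun t =>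
     t * (k * p t + l) - p t / (2 * (1 + p t ^+ 2)) + A * p t + B)
     (k * p x + l + dp x *
       (x * k + A - (1 - p x ^+ 2) / (2 * (1 + p x ^+ 2) ^+ 2))).
    by derive_auto; [rewrite mulf_neq0 // pnatr_eq0|field].
  have := is_derive_zero_on oI aff Ix hder.
  have := dpx; rewrite (riccati _ Ix) mulf_eq0 (negbTE n1) /= => kpl0 D0.
  (* As [dp x] is [(1 + p^2) (k p + l)], the derivative is divisible by the nonzero factor
     [k p + l]. *)
  have {}D0 : 1 + (1 + p x ^+ 2) * (x * k + A)
       - (1 - p x ^+ 2) / (2 * (1 + p x ^+ 2)) = 0.
    by apply: (mulfI kpl0); rewrite mulr0 -[RHS]D0; field.
  have xk : x * k = - A - (1 - (1 - p x ^+ 2) / (2 * (1 + p x ^+ 2))) / (1 + p x ^+ 2).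
    by apply: (mulfI n1); apply/eqP; rewrite -subr_eq0 -[X in _ == X]D0; apply/eqP; field.
  (* Multiplying by [k] lets [x k] be substituted without dividing by [k], which may be zero. *)
  have := congr1 ( *%R k) (aff _ Ix); rewrite mulr0 => E0.
  have {}E0 : (x * k) * (k * p x + l) - k * (p x / (2 * (1 + p x ^+ 2)))
      + k * A * p x + k * B = 0 by rewrite -[RHS]E0; ring.
  rewrite xk in E0.
  apply: (mulfI (x := (2 * (1 + p x ^+ 2) ^+ 2)^-1)).
    by rewrite invr_eq0 mulf_neq0 ?pnatr_eq0 // expf_neq0.
  by rewrite mulr0 -[RHS]E0 /F0 /C; field.
have P1 := derive_zero_along oK hpK dpK d0 P0.
have P2 := derive_zero_along oK hpK dpK d1 P1.
have P3 := derive_zero_along oK hpK dpK d2 P2.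
have P4 := derive_zero_along oK hpK dpK d3 P3.
(* The derivatives of [F0] are read from the highest down, giving [C], [k] and [l] in turn. *)
have C0 : C = 0 by have := P4 _ Kx0; lra.
have k0 : k = 0 by have := P3 _ Kx0; rewrite /F3 C0; lra.
have l0 : l = 0 by have := P2 _ Kx0; rewrite /F2 C0 k0; lra.
by move: dpx0; rewrite (riccati _ Ix0) k0 l0 mul0r addr0 mulr0 eqxx.
Qed.

(* The case in which the coefficient of [p'] in [defect_deriv_yyy] vanishes. *)
Lemma log_deriv_absurd (R : realType) (K : set R) (al al1 al2 : R -> R)
    (p y0 : R) :
  open K -> K y0 ->
  (forall y, K y -> is_derive y 1 al (al1 y)) ->
  (forall y, K y -> is_derive y 1 al1 (al2 y)) ->
  (forall y, K y -> al y = - 3 * y / (4 + y ^+ 2)) ->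
  (forall y, K y -> al1 y + (p + y / 2) * al2 y = 0) -> False.
Proof.
move=> oK Ky0 dal dal1 alE H.
have n4 (y : R) : 4 + y ^+ 2 != 0 by rewrite gt_eqF // ltr_pwDl // sqr_ge0.
have al1E y : K y -> al1 y = - 3 * (4 - y ^+ 2) / (4 + y ^+ 2) ^+ 2.
  move=> Ky; apply: (is_derive_unique_on oK alE Ky (dal y Ky)).
  by derive_auto; [exact: n4|rewrite /=; field].
have al2E y : K y -> al2 y = - 6 * y * (y ^+ 2 - 12) / (4 + y ^+ 2) ^+ 3.
  move=> Ky; apply: (is_derive_unique_on oK al1E Ky (dal1 y Ky)).
  by derive_auto; [rewrite expf_neq0 // n4|rewrite /=; field].
(* The last hypothesis multiplied by [- (4 + y^2)^3 / 6]; the quartic terms cancel. *)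
pose F0 (y : R) := p * y ^+ 3 - 12 * p * y - 6 * y ^+ 2 + 8.
pose F1 (y : R) := 3 * p * y ^+ 2 - 12 * p - 12 * y.
pose F2 (y : R) := 6 * p * y - 12.
have d0 (y : R) : is_derive y 1 F0 (F1 y).
  by rewrite /F0 /F1; derive_auto; rewrite /=; ring.
have d1 (y : R) : is_derive y 1 F1 (F2 y).
  by rewrite /F1 /F2; derive_auto; rewrite /=; ring.
have d2 (y : R) : is_derive y 1 F2 (6 * p).
  by rewrite /F2; derive_auto; rewrite /=; ring.
have P0 y : K y -> F0 y = 0.
  move=> Ky; apply: (mulfI (x := - 6 / (4 + y ^+ 2) ^+ 3)).
    by rewrite mulf_neq0 ?oppr_eq0 ?pnatr_eq0 // invr_eq0 expf_neq0.
  by rewrite mulr0 -[RHS](H _ Ky) al1E // al2E // /F0; field.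
have hid (y : R) : K y -> is_derive y 1 (fun t : R => t) (1 : R).
  by move=> _; exact: is_derive_fun_id.
have n1 (y : R) : K y -> (1 : R) != 0 by rewrite oner_eq0.
have P1 := derive_zero_along oK hid n1 d0 P0.
have P2 := derive_zero_along oK hid n1 d1 P1.
have P3 := derive_zero_along oK hid n1 d2 P2.
(* The third derivative [6 p] vanishes, and then the second one is [- 12]. *)
have p0 : p = 0 by have := P3 _ Ky0; lra.
by have := P2 _ Ky0; rewrite /F2 p0; lra.
Qed.

(** * Repeated differentiation in [y] and the dichotomy *)

Section MinimalEquation.
Variables (R : realType) (I J : set R) (p p' p'' v v1 v2 v3 v4 v5 : R -> R).
Hypotheses (oI : open I) (iI : is_interval I) (oJ : open J).
Hypotheses (dp : forall x, I x -> is_derive x 1 p (p' x))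
  (dp' : forall x, I x -> is_derive x 1 p' (p'' x))
  (dv : forall y, J y -> is_derive y 1 v (v1 y))
  (dv1 : forall y, J y -> is_derive y 1 v1 (v2 y))
  (dv2 : forall y, J y -> is_derive y 1 v2 (v3 y))
  (dv3 : forall y, J y -> is_derive y 1 v3 (v4 y))
  (dv4 : forall y, J y -> is_derive y 1 v4 (v5 y)).

Local Notation w x y := (x + (v y - y * v1 y) / 2).

Hypothesis defect0 : forall x y, I x -> J y ->
  (1 + p x ^+ 2) * (p x + y / 2) * v2 y + v1 y + p x * w x y
  - (1 + v1 y ^+ 2 + w x y ^+ 2) * p' x = 0.

(** The [y]-derivative of [w] is [- y v2 / 2], so every term carries [v2] or [v3]; division by [v2]
    then leaves only its logarithmic derivative. *)
Lemma defect_deriv_y x y : I x -> J y ->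
  (1 + p x ^+ 2) * (v2 y / 2 + (p x + y / 2) * v3 y) + v2 y
  - p x * (y * v2 y / 2)
  - p' x * (2 * v1 y * v2 y - w x y * (y * v2 y)) = 0.
Proof.
move=> Ix Jy.
have hv0 := dv Jy; have hv1 := dv1 Jy; have hv2 := dv2 Jy.
notypeclasses refine (is_derive_zero_on oJ (fun y => @defect0 x y Ix) Jy _).
by derive_auto; rewrite /=; field.
Qed.

Definition log_deriv y : R := v3 y / v2 y.
Definition log_deriv' y : R := v4 y / v2 y - log_deriv y ^+ 2.
Definition log_deriv'' y : R :=
  v5 y / v2 y - v4 y * v3 y / v2 y ^+ 2 - 2 * log_deriv y * log_deriv' y.

Local Notation K := [set y | J y /\ v2 y != 0].

Let oK : open K.
Proof. exact: open_neq0 oJ dv2. Qed.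

Lemma is_derive_log_deriv y : K y -> is_derive y 1 log_deriv (log_deriv' y).
Proof.
case=> Jy v2y; have hv2 := dv2 Jy; have hv3 := dv3 Jy.
by rewrite /log_deriv' /log_deriv; derive_auto => //; field.
Qed.

Lemma is_derive_log_deriv' y : K y -> is_derive y 1 log_deriv' (log_deriv'' y).
Proof.
move=> Ky; have hd := is_derive_log_deriv Ky.
case: Ky => Jy v2y; have hv2 := dv2 Jy; have hv4 := dv4 Jy.
by rewrite /log_deriv'' /log_deriv'; derive_auto => //; rewrite /log_deriv'; field.
Qed.

Lemma defect_deriv_y_div x y : I x -> K y ->
  (1 + p x ^+ 2) * (2^-1 + (p x + y / 2) * log_deriv y) + 1 - p x * y / 2
  - p' x * (2 * v1 y - y * w x y) = 0.
Proof.
move=> Ix [Jy v2y]; apply: (mulfI v2y); rewrite mulr0 -[RHS](defect_deriv_y Ix Jy).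
by rewrite /log_deriv; field.
Qed.

Lemma defect_deriv_yy x y : I x -> K y ->
  (1 + p x ^+ 2) * (log_deriv y / 2 + (p x + y / 2) * log_deriv' y) - p x / 2
  - p' x * ((2 + y ^+ 2 / 2) * v2 y - w x y) = 0.
Proof.
move=> Ix Ky; have hd := is_derive_log_deriv Ky; have [Jy _] := Ky.
have hv0 := dv Jy; have hv1 := dv1 Jy.
notypeclasses refine (is_derive_zero_on oK (fun y => @defect_deriv_y_div x y Ix) Ky _).
by derive_auto; rewrite /=; field.
Qed.

(** The [y]-derivative of [(2 + y^2 / 2) v2 - w]; the summand [x] of [w] has disappeared. *)
Definition slope_factor y : R := (2 + y ^+ 2 / 2) * v3 y + 3 / 2 * y * v2 y.

Lemma defect_deriv_yyy x y : I x -> K y ->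
  (1 + p x ^+ 2) * (log_deriv' y + (p x + y / 2) * log_deriv'' y)
  - p' x * slope_factor y = 0.
Proof.
move=> Ix Ky; have hd := is_derive_log_deriv Ky; have hd' := is_derive_log_deriv' Ky.
have [Jy _] := Ky.
have hv0 := dv Jy; have hv1 := dv1 Jy; have hv2 := dv2 Jy.
notypeclasses refine (is_derive_zero_on oK (fun y => @defect_deriv_yy x y Ix) Ky _).
rewrite /slope_factor.
by derive_auto; rewrite /=; field.
Qed.

(** If [slope_factor] is nonzero at some [y1], freezing [y = y1] gives a differential equation for
    [p] alone. Otherwise it vanishes on [K], which fixes [log_deriv] and is contradictory. *)
Lemma slope_constant_of_second_derivative_neq0 : K !=set0 ->
  forall x, I x -> p' x = 0.
Proof.
move=> [y0 Ky0].
have [[y1 Ky1 ty1]|no] := pselect (exists2 y, K y & slope_factor y != 0).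
  (* [k] and [l] come from solving [defect_deriv_yyy] at [y1] for [p']. *)
  pose k := log_deriv'' y1 / slope_factor y1.
  pose l := (log_deriv' y1 + y1 / 2 * log_deriv'' y1) / slope_factor y1.
  (* In [defect_deriv_yy] at [y1] the coefficient of [- p'] is [G - x]; dividing by [1 + p^2] and
     collecting powers of [p] gives the [A] and [B] below. *)
  pose G := (2 + y1 ^+ 2 / 2) * v2 y1 - w 0 y1.
  have ric x : I x -> p' x = (1 + p x ^+ 2) * (k * p x + l).
    move=> Ix; apply: (mulIf ty1); apply/eqP; rewrite -subr_eq0 -oppr_eq0.
    by rewrite -(defect_deriv_yyy Ix Ky1) /k /l; apply/eqP; field.
  apply: (riccati_constant (k := k) (l := l)
    (A := log_deriv' y1 - k * G)
    (B := (log_deriv y1 + y1 * log_deriv' y1) / 2 - l * G) oI dp dp' ric) => x Ix.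
  apply: (mulfI (onep_sqr_neq0 (p x))); rewrite mulr0.
  rewrite -[RHS](defect_deriv_yy Ix Ky1) (ric _ Ix) /G.
  by have := onep_sqr_neq0 (p x) => n1; field.
have t0 y : K y -> slope_factor y = 0.
  by move=> Ky; apply/eqP; apply/negPn/negP => ty; apply: no; exists y.
move=> x Ix; exfalso.
apply: (log_deriv_absurd (p := p x) oK Ky0 is_derive_log_deriv
  is_derive_log_deriv') => y Ky.
  have n4 : 4 + y ^+ 2 != 0 by rewrite gt_eqF // ltr_pwDl // sqr_ge0.
  have [_ v2y] := Ky.
  apply: (mulfI (x := (4 + y ^+ 2) * v2 y)); first by rewrite mulf_neq0.
  apply/eqP; rewrite -subr_eq0; apply/eqP.
  by rewrite -[RHS](mulr0 2) -(t0 _ Ky) /slope_factor /log_deriv; field; rewrite n4 v2y.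
apply: (mulfI (onep_sqr_neq0 (p x))); rewrite mulr0.
by rewrite -[RHS](defect_deriv_yyy Ix Ky) t0 // mulr0 subr0.
Qed.

Lemma minimal_dichotomy :
  (forall x, I x -> p x = 0) \/ (forall y, J y -> v2 y = 0).
Proof.
have [K0|noK] := pselect (K !=set0); last first.
  right=> y Jy; apply/eqP; apply/negPn/negP => v2y.
  by apply: noK; exists y.
left=> x Ix; have [y [Jy _]] := K0.
have p'0 := slope_constant_of_second_derivative_neq0 K0.
have pc t : I t -> p t = p x.
  move=> It; apply: (is_derive0_interval iI _ It Ix) => s Is.
  by rewrite -(p'0 _ Is); exact: dp.
(* With [p] constant the defect is affine in [x] with slope [p x]. *)
notypeclasses refine (is_derive_zero_on (x := x) (f := fun t =>
    (1 + p x ^+ 2) * (p x + y / 2) * v2 y + v1 y + p x * w t y) oI _ Ix _).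
  by move=> t It; rewrite -(defect0 It Jy) p'0 // (pc t) //; ring.
by derive_auto; ring.
Qed.

End MinimalEquation.

(** * Integration of the two ordinary differential equations *)

Section HyperbolaEquation.
Variables (R : realType) (J : set R) (v v1 v2 v3 : R -> R).
Hypotheses (hJ : open_interval J)
  (dv : forall y, J y -> is_derive y 1 v (v1 y))
  (dv1 : forall y, J y -> is_derive y 1 v1 (v2 y))
  (dv2 : forall y, J y -> is_derive y 1 v2 (v3 y)).

Lemma hyperbola_of_ode : (forall y, J y -> y / 2 * v2 y + v1 y = 0) ->
  exists a b, forall y, J y -> y != 0 -> v y = a / y + b.
Proof.
move=> ode; have [oJ iJ [y0 Jy0]] := hJ.
(* The derivative of [y^2 v1] is [2 y] times the equation, so the constancy persists across
   [y = 0]. *)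
have cst y z : J y -> J z -> y ^+ 2 * v1 y = z ^+ 2 * v1 z.
  move=> Jy Jz; apply: (is_derive0_interval (f := fun t => t ^+ 2 * v1 t) iJ _ Jy Jz).
  move=> t Jt; have hv1 := dv1 Jt.
  by derive_auto; rewrite /= -[RHS](mulr0 (2 * t)) -(ode _ Jt); field.
(* If [0] lies in [J], the constant value of [y^2 v1] is zero and [v] is constant. *)
have [J0|nJ0] := pselect (J 0).
  exists 0, (v 0) => y Jy _; rewrite mul0r add0r.
  apply: (is_derive0_interval iJ _ Jy J0) => t Jt.
  suff <- : v1 t = 0 by exact: dv.
  have [->|t0] := eqVneq t 0; first by rewrite -[RHS](ode _ J0) mul0r mul0r add0r.
  apply: (mulfI (x := t ^+ 2)); first by rewrite expf_neq0.
  by rewrite (cst _ _ Jt J0) expr0n /= mul0r mulr0.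
have n0 t : J t -> t != 0 by move=> Jt; apply/negP => /eqP t0; apply: nJ0; rewrite -t0.
pose c := y0 ^+ 2 * v1 y0.
exists (- c), (v y0 + c / y0) => y Jy _.
suff -> : v y0 + c / y0 = v y + c / y by rewrite mulNr; ring.
apply: (is_derive0_interval (f := fun t => v t + c / t) iJ _ Jy0 Jy) => t Jt.
have hv := dv Jt; have t0 := n0 _ Jt.
derive_auto => //.
by rewrite /c (cst _ _ Jy0 Jt); field.
Qed.

(** Off zero the formula is differentiated twice; at zero, where it says nothing, continuity of the
    left-hand side takes over. *)
Lemma hyperbola_ode a b : (forall y, J y -> y != 0 -> v y = a / y + b) ->
  forall y, J y -> y / 2 * v2 y + v1 y = 0.
Proof.
move=> vE; have [oJ _ _] := hJ.
have did (y : R) : J y -> is_derive y 1 (fun t : R => t) (1 : R).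
  by move=> _; exact: is_derive_fun_id.
pose K := [set y | J y /\ (fun t : R => t) y != 0].
have oK : open K by exact: open_neq0 oJ did.
have vK y : K y -> v y = a / y + b by case; exact: vE.
have v1K y : K y -> v1 y = - a / y ^+ 2.
  move=> Ky; have [Jy y0] := Ky.
  apply: (is_derive_unique_on oK vK Ky (dv Jy)).
  by derive_auto => //; rewrite /=; field.
have v2K y : K y -> v2 y = 2 * a / y ^+ 3.
  move=> Ky; have [Jy y0] := Ky.
  apply: (is_derive_unique_on oK v1K Ky (dv1 Jy)).
  by derive_auto; [rewrite expf_neq0|rewrite /=; field].
have off0 y : K y -> y / 2 * v2 y + v1 y = 0.
  by move=> Ky; have [_ y0] := Ky; rewrite v1K // v2K //; field.
(* A point of [J] where the equation fails would be isolated. *)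
move=> y Jy; apply/eqP; apply/negPn/negP => gy.
pose g t := t / 2 * v2 t + v1 t.
have oL : open [set t | J t /\ g t != 0].
  apply: (open_neq0 (df := fun t => 2^-1 * v2 t + t / 2 * v3 t + v2 t) oJ) => t Jt.
  by have h1 := dv1 Jt; have h2 := dv2 Jt; rewrite /g; derive_auto; ring.
have L0 t : J t /\ g t != 0 -> t = 0.
  move=> [Jt gt]; apply/eqP; apply/negPn/negP => t0.
  by move: gt; rewrite /g off0 ?eqxx.
have := is_derive_zero_on oL L0 (conj Jy gy) (is_derive_fun_id y).
by move/eqP; rewrite oner_eq0.
Qed.

End HyperbolaEquation.

(** * The linear equation for [u'] when [v] is affine *)

Section AffineProfile.
Variables (R : realType) (a b : R).

Local Notation S x := (Num.sqrt (4 * (1 + a ^+ 2) + (2 * x + b) ^+ 2)).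

Lemma radicand_gt0 x : 0 < 4 * (1 + a ^+ 2) + (2 * x + b) ^+ 2.
Proof.
rewrite ltr_pwDl ?sqr_ge0 // mulr_gt0 //.
by rewrite ltr_pwDl // sqr_ge0.
Qed.

(** [S x] exceeds the absolute value of [2 x + b]. *)
Lemma ln_argument_gt0 x : 0 < 2 * x + b + S x.
Proof.
rewrite -ltrBlDl sub0r; apply: le_lt_trans (ler_norm _) _.
rewrite normrN -sqrtr_sqr ltr_sqrt ?radicand_gt0 //.
by rewrite ltrDr mulr_gt0 // ltr_pwDl // sqr_ge0.
Qed.

Lemma is_derive_S (x : R) : is_derive x 1 (fun t => S t) (2 * (2 * x + b) / S x).
Proof.
have S0 : S x != 0 by rewrite sqrtr_eq0 -ltNge radicand_gt0.
derive_auto; first exact: radicand_gt0.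
by rewrite /=; field.
Qed.

(** The two terms in [c1] are the classical primitive of [c1 S]. *)
Lemma is_derive_profile (c c1 x : R) :
  is_derive x 1 (fun t => (a * t ^+ 2 + a * b * t + c) / (2 * (1 + a ^+ 2))
     + c1 * (t / 2 + b / 4) * S t + c1 * (1 + a ^+ 2) * ln (2 * t + b + S t))
   (a * (x + b / 2) / (1 + a ^+ 2) + c1 * S x).
Proof.
have hS := is_derive_S x; have n1 := onep_sqr_neq0 a.
have S0 : S x != 0 by rewrite sqrtr_eq0 -ltNge radicand_gt0.
have L0 : 2 * x + b + S x != 0 by rewrite gt_eqF // ln_argument_gt0.
have SE : S x ^+ 2 = 4 * (1 + a ^+ 2) + (2 * x + b) ^+ 2.
  by rewrite sqr_sqrtr // ltW // radicand_gt0.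
derive_auto; first exact: ln_argument_gt0.
(* Expressing [1 + a^2] through [S x] leaves an identity valid with [S x] as an indeterminate. *)
have -> : c1 * (1 + a ^+ 2) = c1 * (S x ^+ 2 - (2 * x + b) ^+ 2) / 4.
  by rewrite SE; field.
rewrite /=; move: S0 L0 {SE hS}; move: (S x) => s S0 L0.
by field; rewrite n1 L0 S0.
Qed.

Lemma profile_of_ode (I : set R) (u p p' : R -> R) :
  open_interval I ->
  (forall x, I x -> is_derive x 1 u (p x)) ->
  (forall x, I x -> is_derive x 1 p (p' x)) ->
  (forall x, I x -> (1 + a ^+ 2 + (x + b / 2) ^+ 2) * p' x = a + p x * (x + b / 2)) ->
  exists c c1, forall x, I x ->
    u x = (a * x ^+ 2 + a * b * x + c) / (2 * (1 + a ^+ 2))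
      + c1 * (x / 2 + b / 4) * S x + c1 * (1 + a ^+ 2) * ln (2 * x + b + S x).
Proof.
move=> [_ iI [x0 Ix0]] du dp ode.
have n1 := onep_sqr_neq0 a.
(* Variation of constants: [a (x + b / 2) / (1 + a^2)] is a particular solution and [S] solves the
   homogeneous equation. *)
pose h (x : R) := (p x - a * (x + b / 2) / (1 + a ^+ 2)) / S x.
have hc x : I x -> h x = h x0.
  move=> Ix; apply: (is_derive0_interval iI _ Ix Ix0) => t It.
  have hp := dp _ It; have hS := is_derive_S t.
  have S0 : S t != 0 by rewrite sqrtr_eq0 -ltNge radicand_gt0.
  have SE : S t ^+ 2 = 4 * (1 + a ^+ 2 + (t + b / 2) ^+ 2).
    by rewrite sqr_sqrtr ?ltW ?radicand_gt0 //; field.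
  rewrite /h; derive_auto => //.
  apply: (mulfI (x := S t ^+ 3)); first by rewrite expf_neq0.
  (* Times [S t ^ 3], the derivative of [h] is a combination of [E0], the differential equation, and
     [E1], the definition of [S]. *)
  have E0 : S t ^+ 2 * p' t - 4 * (a + p t * (t + b / 2)) = 0.
    by rewrite SE -(ode _ It); ring.
  have E1 : 4 * (1 + a ^+ 2 + (t + b / 2) ^+ 2) - S t ^+ 2 = 0 by rewrite SE subrr.
  have <- : (S t ^+ 2 * p' t - 4 * (a + p t * (t + b / 2))) +
    (4 * (1 + a ^+ 2 + (t + b / 2) ^+ 2) - S t ^+ 2) * (a / (1 + a ^+ 2)) = S t ^+ 3 * 0.
    by rewrite E0 E1 mul0r addr0 mulr0.
  move: S0 {SE hS E0 E1}; move: (S t) => s S0.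
  by rewrite /=; field; rewrite ?n1 ?S0.
pose f (x : R) := (a * x ^+ 2 + a * b * x + 0) / (2 * (1 + a ^+ 2))
      + h x0 * (x / 2 + b / 4) * S x + h x0 * (1 + a ^+ 2) * ln (2 * x + b + S x).
(* [c] contributes the constant [c / (2 (1 + a^2))], which must equal the constant difference
   [u - f]. *)
exists (2 * (1 + a ^+ 2) * (u x0 - f x0)), (h x0) => x Ix.
have <- : u x - f x = u x0 - f x0.
  apply: (is_derive0_interval (f := fun t => u t - f t) iI _ Ix Ix0) => t It.
  have hu := du _ It; have hf := is_derive_profile 0 (h x0) t.
  have S0 : S t != 0 by rewrite sqrtr_eq0 -ltNge radicand_gt0.
  rewrite /f.
  notypeclasses refine (is_derive_eq (is_derive_funD hu (is_derive_funN hf)) _).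
  by rewrite -(hc _ It) /h; field; rewrite ?n1 ?S0.
by rewrite /f; field.
Qed.

Lemma profile_ode (I : set R) (u p p' : R -> R) c c1 :
  open I ->
  (forall x, I x -> is_derive x 1 u (p x)) ->
  (forall x, I x -> is_derive x 1 p (p' x)) ->
  (forall x, I x ->
    u x = (a * x ^+ 2 + a * b * x + c) / (2 * (1 + a ^+ 2))
      + c1 * (x / 2 + b / 4) * S x + c1 * (1 + a ^+ 2) * ln (2 * x + b + S x)) ->
  forall x, I x -> (1 + a ^+ 2 + (x + b / 2) ^+ 2) * p' x = a + p x * (x + b / 2).
Proof.
move=> oI du dp uE x Ix.
have n1 := onep_sqr_neq0 a.
have pE t : I t -> p t = a * (t + b / 2) / (1 + a ^+ 2) + c1 * S t.
  move=> It.
  exact: (is_derive_unique_on oI uE It (du _ It) (is_derive_profile c c1 t)).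
have hS := is_derive_S x.
have S0 : S x != 0 by rewrite sqrtr_eq0 -ltNge radicand_gt0.
have SE : S x ^+ 2 = 4 * (1 + a ^+ 2 + (x + b / 2) ^+ 2).
  by rewrite sqr_sqrtr ?ltW ?radicand_gt0 //; field.
have dE : is_derive x 1 (fun t => a * (t + b / 2) / (1 + a ^+ 2) + c1 * S t)
    (a / (1 + a ^+ 2) + c1 * (2 * (2 * x + b) / S x)).
  by derive_auto; field; rewrite ?n1 ?S0.
rewrite (is_derive_unique_on oI pE Ix (dp _ Ix) dE) (pE _ Ix).
have -> : 1 + a ^+ 2 + (x + b / 2) ^+ 2 = S x ^+ 2 / 4 by rewrite SE; field.
have E1 : 4 * (1 + a ^+ 2 + (x + b / 2) ^+ 2) - S x ^+ 2 = 0 by rewrite SE subrr.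
apply/eqP; rewrite -subr_eq0; apply/eqP.
(* The two sides differ by exactly this multiple of [E1]. *)
rewrite -[RHS](mulr0 (- (a / (4 * (1 + a ^+ 2))))) -E1.
move: S0 {SE hS E1 dE}; move: (S x) => s S0.
by field; rewrite ?n1 ?S0.
Qed.

End AffineProfile.

(** * Both directions of the classification *)

Unset Implicit Arguments.

Theorem theorem3p9 (R : realType) (I J : set R) (u v : R -> R)
    (hI : open_interval I) (hJ : open_interval J)
    (hu : smooth_on I u) (hv : smooth_on J v) :
  minimal_on nil_metric (rectangle I J) (translation_surface6 u v) <->
  (exists u0 a b : R,
     (forall x, I x -> u x = u0) /\
     (forall y, J y -> y != 0 -> v y = a / y + b)) \/
  (exists a b c c1 : R,
     (forall y, J y -> v y = a * y + b) /\
     (forall x, I x ->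
        u x = (a * x ^+ 2 + a * b * x + c) / (2 * (1 + a ^+ 2))
          + c1 * (x / 2 + b / 4)
              * Num.sqrt (4 * (1 + a ^+ 2) + (2 * x + b) ^+ 2)
          + c1 * (1 + a ^+ 2)
              * ln (2 * x + b
                    + Num.sqrt (4 * (1 + a ^+ 2) + (2 * x + b) ^+ 2)))).
Proof.
have [oI iI [x0 Ix0]] := hI; have [oJ iJ [y0 Jy0]] := hJ.
have du0 x (Ix : I x) : is_derive x 1 u _ := smooth_is_derive 0 hu Ix.
have du n x (Ix : I x) := smooth_is_derive n hu Ix.
have dv0 y (Jy : J y) : is_derive y 1 v _ := smooth_is_derive 0 hv Jy.
have dv n y (Jy : J y) := smooth_is_derive n hv Jy.
rewrite (minimal_translation6P oI oJ hu hv); split=> [defect0|].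
  have [p0|v20] := minimal_dichotomy oI iI oJ (du 1%N) (du 2%N) dv0 (dv 1%N)
    (dv 2%N) (dv 3%N) (dv 4%N) defect0.
  - left; exists (u x0).
    (* For [p = 0], hence [p' = 0], the defect reduces to [y v'' / 2 + v']. *)
    have [y Jy|a [b vE]] := hyperbola_of_ode hJ dv0 (dv 1%N).
      rewrite -(defect0 x0 y Ix0 Jy) /minimal_defect p0 //.
      rewrite (is_derive_zero_on oI p0 Ix0 (du 1%N _ Ix0)).
      by field.
    exists a, b; split=> // x Ix.
    apply: (is_derive0_interval iI _ Ix Ix0) => t It.
    by rewrite -(p0 _ It); exact: du0.
  - right; pose a := derive1n 1 v y0; pose b := v y0 - a * y0.
    have v1E y : J y -> derive1n 1 v y = a.
      move=> Jy; apply: (is_derive0_interval iJ _ Jy Jy0) => t Jt.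
      by rewrite -(v20 _ Jt); exact: dv.
    have vE y : J y -> v y = a * y + b.
      move=> Jy; suff : v y - a * y = v y0 - a * y0 by rewrite /b => <-; ring.
      apply: (is_derive0_interval (f := fun t => v t - a * t) iJ _ Jy Jy0) => t Jt.
      have h := dv0 _ Jt; derive_auto.
      by rewrite (v1E _ Jt); ring.
    (* For [v = a y + b], [frame3] is [x + b / 2], and the vanishing defect is the linear equation
       for [u']. *)
    have [x Ix|c [c1 uE]] := profile_of_ode (a := a) (b := b) hI du0 (du 1%N).
      apply/eqP; rewrite -subr_eq0 -oppr_eq0; apply/eqP.
      rewrite -(defect0 x y0 Ix Jy0) /minimal_defect /frame3 v20 // v1E // vE //.
      by field.
    by exists a, b, c, c1.
case=> [[c [a [b [uE vE]]]]|[a [b [c [c1 [vE uE]]]]]] x y Ix Jy.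
  have u1E t : I t -> derive1n 1 u t = 0.
    move=> It.
    exact: (is_derive_unique_on oI uE It (du0 _ It) (is_derive_fun_cst t c)).
  rewrite /minimal_defect u1E // (is_derive_zero_on oI u1E Ix (du 1%N _ Ix)).
  by rewrite -[RHS](hyperbola_ode hJ dv0 (dv 1%N) (dv 2%N) vE Jy); ring.
have v1E t : J t -> derive1n 1 v t = a.
  move=> Jt; apply: (is_derive_unique_on oJ vE Jt (dv0 _ Jt)).
  by derive_auto; ring.
have v2E t : J t -> derive1n 2 v t = 0.
  move=> Jt.
  exact: (is_derive_unique_on oJ v1E Jt (dv 1%N _ Jt) (is_derive_fun_cst t a)).
have := profile_ode oI du0 (du 1%N) uE Ix.
rewrite /minimal_defect /frame3 v2E // v1E // vE // => ode.
apply/eqP; rewrite -oppr_eq0; apply/eqP.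
rewrite -[RHS](subrr (a + derive1n 1 u x * (x + b / 2))) -{1}ode.
by field.
Qed.
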